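(* Let $m\ge1$ be an integer and $X\sim\mathrm{CMP}(m^{-m},m)$. Then for all integers $n\ge0$, $$m^n\,\mathbb E[X^n]=\sum_{r=0}^{m-1}B^{(m,r)}_n\,\frac{C^{(m)}_r(1)}{C^{(m)}_0(1)}=\frac{S_m(n)}{C^{(m)}_0(1)},\qquad S_m(n)=\sum_{k=0}^\infty\frac{(mk)^n}{(m^kk!)^m}.$$ For $m=1$ ($X\sim\mathrm{Poisson}(1)$) this is $\mathbb E[X^n]=B_n$, the $n$-th Bell number; for $m=2$ ($X\sim\mathrm{CMP}(1/4,2)$), $$2^n\,\mathbb E[X^n]=B^{(2,0)}_n+B^{(2,1)}_n\,\frac{I_1(1)}{I_0(1)}.$$
   Context: The Conway--Maxwell--Poisson distribution $\mathrm{CMP}(\lambda,\nu)$ (with $\lambda,\nu>0$) has probability mass function $$\mathbb P(X=k)=\frac{\lambda^k}{(k!)^\nu Z(\lambda,\nu)},\quad k=0,1,2,\dots,\qquad Z(\lambda,\nu)=\sum_{j=0}^\infty\frac{\lambda^j}{(j!)^\nu}.$$ The convention $0^0=1$ is used. For $0\le r<m$, the primitive $m$-Bell sequence $(B^{(m,r)}_n)_{n\ge0}$ is the unique solution of $a_{n+m}=\sum_{k=0}^n\binom nk m^{\,n-k}a_k$ $(n\ge0)$ with $B^{(m,r)}_n=\delta_{n,r}$ for $0\le n<m$. The hyper-Bessel carriers are $$C^{(m)}_0(x)=\sum_{k=0}^\infty\frac{(x/m)^{mk}}{(k!)^m},\qquad C^{(m)}_r(x)=\sum_{k=0}^\infty\frac{(x/m)^{mk+m-r}}{(k!)^r((k+1)!)^{m-r}}\quad(1\le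 r\le m-1).$$ $I_0,I_1$ are modified Bessel functions of the first kind. *)

(* Defs.v *)
From HB Require Import structures.
From mathcomp Require Import all_boot all_order all_algebra.
From mathcomp Require Import all_classical all_reals all_analysis.

Set Implicit Arguments.
Unset Strict Implicit.
Unset Printing Implicit Defensive.

Import Order.TTheory GRing.Theory Num.Theory.
Import numFieldNormedType.Exports.

(* The n-th Bell number: the number of set partitions of {0, ..., n-1}. *)
Definition bell (n : nat) : nat :=
  #|[pred Q : {set {set 'I_n}} | finset.partition Q (finset.setTfor 'I_n)]|.

Definition is_primitive_mbell (m r : nat) (a : nat -> nat) : Prop :=
  (forall n, n < m -> a n = (n == r)) /\
  (forall n, a (n + m) = \sum_(k < n.+1) 'C(n, k) * m ^ (n - k) * a k).

(* mbell_seq m r N lists the first N terms of the sequence mbell m r; for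
   0 < m, mbell m r is the unique solution of is_primitive_mbell m r (see
   mbellP and mbell_uniq). *)
Fixpoint mbell_seq (m r N : nat) : seq nat :=
  if N is n.+1 then
    let s := mbell_seq m r n in
    rcons s (if n < m then (n == r : nat) else
      \sum_(k < (n - m).+1) 'C(n - m, k) * m ^ (n - m - k) * nth 0 s k)
  else [::].

Definition mbell (m r n : nat) : nat := nth 0 (mbell_seq m r n.+1) n.

Lemma size_mbell_seq m r N : size (mbell_seq m r N) = N.
Proof. by elim: N => //= N IH; rewrite size_rcons IH. Qed.

Lemma nth_mbell_seq m r N k : k < N -> nth 0 (mbell_seq m r N) k = mbell m r k.
Proof.
elim: N => // N IH; rewrite ltnS leq_eqVlt => /predU1P[->//|kN].
by rewrite /= nth_rcons size_mbell_seq kN IH.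
Qed.

Lemma mbellP m r : 0 < m -> is_primitive_mbell m r (mbell m r).
Proof.
move=> m0; split=> n; rewrite {1}/mbell /= nth_rcons size_mbell_seq ltnn eqxx.
  by move=> ->.
rewrite ltnNge leq_addl addnK /=; apply: eq_bigr => k _.
by rewrite nth_mbell_seq// (leq_trans (ltn_ord k))// -addn1 leq_add2l.
Qed.

Lemma mbell_uniq m r a : 0 < m -> is_primitive_mbell m r a -> a =1 mbell m r.
Proof.
move=> m0 [a0 aS] n; have [b0 bS] := mbellP r m0.
elim/ltn_ind: n => n IH; have [nm|mn] := ltnP n m; first by rewrite a0 ?b0.
rewrite -(subnK mn) aS bS; apply: eq_bigr => k _.
rewrite IH// (leq_trans (ltn_ord k))// -[leqRHS](subnK mn) -addn1.
by rewrite leq_add2l.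
Qed.

Local Open Scope classical_set_scope.
Local Open Scope ring_scope.

Section series_functions.
Context {R : realType}.

Definition cmp_Z (lambda nu : R) : R :=
  limn (series (fun j : nat => lambda ^+ j / (j`!%:R `^ nu))).

Definition cmp_pmf (lambda nu : R) (k : nat) : R :=
  lambda ^+ k / ((k`!%:R `^ nu) * cmp_Z lambda nu).

Definition hyper_bessel (m r : nat) (x : R) : R :=
  if r == 0%N then
    limn (series (fun k : nat => (x / m%:R) ^+ (m * k) / (k`!%:R ^+ m)))
  else
    limn (series (fun k : nat => (x / m%:R) ^+ (m * k + m - r) /
                                 (k`!%:R ^+ r * (k.+1)`!%:R ^+ (m - r)))).

Definition S_series (m n : nat) : R :=
  limn (series (fun k : nat => (m * k)%:R ^+ n / (m%:R ^+ k * k`!%:R) ^+ m : R)).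

(* The modified Bessel function of the first kind, of integer order a. *)
Definition besselI (a : nat) (x : R) : R :=
  limn (series (fun k : nat => (x / 2) ^+ (2 * k + a) /
                               (k`!%:R * (k + a)`!%:R))).

End series_functions.

Definition has_pmf (d : measure_display) (T : measurableType d) (R : realType)
    (P : probability T R) (X : {RV P >-> nat}) (p : nat -> R) : Prop :=
  forall k : nat, P (X @^-1` [set k]) = (p k)%:E.

Definition moment (d : measure_display) (T : measurableType d) (R : realType)
    (P : probability T R) (X : {RV P >-> nat}) (n : nat) : \bar R :=
  'E_P [(fun w => (X w)%:R ^+ n : R)%R]%E.

(* Main.v *)
Require Import Defs.
From HB Require Import structures.
From mathcomp Require Import all_boot all_order all_algebra.
From mathcomp Require Import all_classical all_reals all_analysis.
From mathcomp Require Import measurable_realfun ring.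

(** Write w k = (m^k k!)^-m, so that S_m(n) = sum_k (m k)^n w k and the law of
    X is w normalised by S_m(0).  Multiplying w (k+1) by (m (k+1))^m gives back
    w k: the m-th power of m (k+1) is exactly what separates two consecutive
    weights.  Since the term k = 0 of S_m(n+m) vanishes, shifting the index by
    one and expanding (m k + m)^n by the binomial formula yields
      S_m(n+m) = sum_j C(n,j) m^(n-j) S_m(j),
    which is the recurrence of the m-Bell sequences ([S_series_rec]).  The
    sequences B^(m,r), r < m, are the basis of solutions dual to the initial
    values, whence S_m(n) = sum_r B^(m,r)_n S_m(r) ([S_series_mbell]), and for
    r < m the same shift turns S_m(r) into the carrier C^(m)_r(1)
    ([hyper_besselE]).

    The probabilistic side only says that an expectation over a countable
    partition is a series ([moment_series]).  For m = 1 it remains to see that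
    B^(1,0) counts set partitions ([bell_mbell]): removing from a partition the
    block of a chosen point leaves a partition of an arbitrary subset of the
    other points, which is the recurrence again.  For m = 2 the two carriers
    are, term by term, the Bessel functions I_0 and I_1 at 1. *)

Set Implicit Arguments.
Unset Strict Implicit.
Unset Printing Implicit Defensive.

Import Order.TTheory GRing.Theory Num.Theory.
Import numFieldNormedType.Exports.

(** * Bell numbers *)

(** Deleting the block A :\: C of x and putting it back are inverse bijections
    between the partitions of A with that block and the partitions of C. *)
Lemma card_partition_fibre (T : finType) (A C : {set T}) (x : T) :
  x \in A -> C \subset (A :\ x)%SET ->
  #|[pred Q | finset.partition Q A & (A :\: finset.pblock Q x)%SET == C]| =
  #|[pred Q | finset.partition Q C]|.
Proof.
move=> Ax; rewrite subsetD1 => /andP[CA xC].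
pose B := (A :\: C)%SET.
have Bx : x \in B by rewrite !inE Ax xC.
have AB : (A :\: B)%SET = C.
  by rewrite finset.setDDr finset.setDv finset.set0U; apply/finset.setIidPr.
have mem_pblock_part Q : finset.partition Q A -> finset.pblock Q x \in Q.
  by move=> pQ; rewrite pblock_mem// (cover_partition pQ).
have block Q : finset.partition Q A -> (A :\: finset.pblock Q x)%SET = C ->
    finset.pblock Q x = B.
  move=> pQ QC; rewrite /B -QC finset.setDDr finset.setDv finset.set0U.
  by apply/esym/finset.setIidPr/(partitionS pQ)/mem_pblock_part.
rewrite -!sum1_card (reindex_onto (fun Q => B |: Q)%SET
                                  (fun Q => Q :\ B)%SET) /=; last first.
  move=> Q /andP[pQ /eqP QC].
  by rewrite finset.setD1K// -(block Q)// mem_pblock_part.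
apply: eq_bigl => Q; rewrite !inE; apply/idP/idP.
  move=> /andP[/andP[pQ /eqP QC] /eqP QB].
  by rewrite -QB -AB; apply: partitionD1 => //; rewrite finset.setU11.
move=> pQ.
have BQ : B \notin Q.
  apply/negP => /(partitionS pQ)/fintype.subsetP/(_ x Bx).
  by rewrite (negPf xC).
have BC : (B :|: C)%SET = A.
  by rewrite -[RHS](finset.setID A C) finset.setUC (finset.setIidPr CA).
have pBQ : finset.partition (B |: Q)%SET A.
  rewrite -BC; apply: partitionU1 => //.
    by apply/set0Pn; exists x.
  by rewrite -finset.setI_eq0 finset.setIDAC finset.setDIl finset.setDv
             finset.setI0.
rewrite pBQ finset.setU1K// eqxx andbT /=.
rewrite (def_pblock (partition_trivIset pBQ) _ Bx) ?finset.setU11//.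
exact/eqP.
Qed.

(** Grouping the partitions Q of A by the complement C of the block of a fixed
    point x, and then the sets C by cardinality, gives
    sum_k C(#|A| - 1, k) a_k, which is the recurrence defining [mbell 1 0]. *)
Lemma card_partition_mbell (T : finType) (A : {set T}) :
  #|[pred Q | finset.partition Q A]| = mbell 1 0 #|A|.
Proof.
have [a0 aS] := mbellP 0 (ltn0Sn 0).
move: {2}#|A|.+1 (ltnSn #|A|) => N; elim: N A => // N IH A.
have [->|/set0Pn[x Ax]] := eqVneq A finset.set0.
  move=> _; rewrite cards0 a0// -[RHS](card1 (finset.set0 : {set {set T}})).
  by apply: eq_card => Q; rewrite !inE partition_set0.
have cA : #|A| = #|A :\ x|%SET.+1 by rewrite (cardsD1 x) Ax.
rewrite cA ltnS => ltN; pose D := (A :\ x)%SET.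
have -> : #|[pred Q | finset.partition Q A]| =
          \sum_(C : {set T} | C \subset D) mbell 1 0 #|C|.
  pose rest (Q : {set {set T}}) := (A :\: finset.pblock Q x)%SET.
  rewrite -sum1_card (partition_big rest (fun C => C \subset D)); last first.
    move=> Q pQ; apply: finset.setDS.
    by rewrite finset.sub1set mem_pblock (cover_partition pQ).
  apply: eq_bigr => C CD.
  rewrite -IH; last exact: leq_ltn_trans (subset_leq_card CD) ltN.
  by rewrite -(card_partition_fibre Ax CD) -sum1_card.
rewrite -/D -[#|D|.+1]addn1 aS.
have szC (C : {set T}) : C \subset D -> (#|C| < #|D|.+1)%N.
  by rewrite ltnS; apply: subset_leq_card.
rewrite (partition_big (fun C : {set T} => inord #|C| : 'I_#|D|.+1) predT) //=.
apply: eq_bigr => k _.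
rewrite exp1n muln1 -cards_draws -sum_nat_const.
rewrite (eq_bigl (fun C : {set T} =>
    C \in [set C : {set T} | C \subset D & #|C| == k]%SET)); last first.
  move=> C; rewrite !inE; case: (boolP (C \subset D)) => //= CD.
  by rewrite -val_eqE /= inordK ?szC.
by apply: eq_bigr => C; rewrite inE => /andP[_ /eqP->].
Qed.

Lemma bell_mbell n : bell n = mbell 1 0 n.
Proof. by rewrite /bell card_partition_mbell cardsT card_ord. Qed.

Local Open Scope classical_set_scope.
Local Open Scope ring_scope.

(** * Series and moments *)

Section series_lemmas.
Variable R : realType.
Implicit Types (u : R ^nat) (l : R).

Lemma cvg_series_recl u l :
  series (fun k => u k.+1) @ \oo --> l -> series u @ \oo --> u 0%N + l.
Proof.
move=> ul; rewrite -cvg_shiftS.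
have -> : [sequence series u n.+1]_n =
          (fun n => u 0%N + series (fun k => u k.+1) n).
  by apply/funext => n; rewrite /series /= big_nat_recl.
by apply: cvgD => //; exact: cvg_cst.
Qed.

Lemma cvg_series_lincomb (I : finType) (c : I -> R) (u : I -> R ^nat)
    (l : I -> R) :
  (forall i, series (u i) @ \oo --> l i) ->
  series (fun k => \sum_i c i * u i k) @ \oo --> \sum_i c i * l i.
Proof.
move=> ul.
have -> : series (fun k => \sum_i c i * u i k) =
          (fun n => \sum_i c i * series (u i) n).
  apply/funext => n; rewrite /series /= exchange_big /=.
  by apply: eq_bigr => i _; rewrite mulr_sumr.
apply: cvg_big => [|i _]; [exact: add_continuous|exact: cvgMl_tmp (ul i)].
Qed.

End series_lemmas.

Section expectation.
Context d (T : measurableType d) (R : realType).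

(** The events X = k, for k in nat, partition the sample space, and X ^ n is
    constant on each of them. *)
Lemma moment_series (P : probability T R) (X : {RV P >-> nat})
    (p : nat -> R) (n : nat) (l : R) :
  has_pmf X p -> series (fun k => k%:R ^+ n * p k) @ \oo --> l ->
  moment X n = l%:E.
Proof.
move=> Xp pl; rewrite /moment unlock.
have mX k : measurable (X @^-1` [set k]).
  by rewrite -[_ @^-1` _]setTI; exact: measurable_funPT.
have XT : \bigcup_k (X @^-1` [set k]) = setT.
  by apply/seteqP; split => // w _; exists (X w).
rewrite -XT ge0_integral_bigcup//=; last 2 first.
- rewrite XT; apply/measurable_EFinP.
  exact: (measurableT_comp (f := fun k : nat => k%:R ^+ n : R)).
- exact: trivIset_preimage1.
transitivity (limn (eseries (fun k => (k%:R ^+ n * p k)%:E))).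
  congr (limn _); apply/funext => N; apply: eq_bigr => k _.
  rewrite (eq_integral (cst (k%:R ^+ n)%:E)); last first.
    by move=> w; rewrite inE /= => ->.
  by rewrite integral_cst//= Xp EFinM.
rewrite -(cvg_lim _ pl)// -EFin_lim; last by apply/cvg_ex; exists l.
by congr (limn _); apply/funext => N; rewrite /= /eseries /series /= sumEFin.
Qed.

End expectation.

(** * The series S_m(n) *)

Section S_series_theory.
Variables (R : realType) (m : nat).
Hypothesis m_gt0 : (0 < m)%N.

Definition S_term (n k : nat) : R :=
  (m * k)%:R ^+ n / (m%:R ^+ k * k`!%:R) ^+ m.

Let m_neq0 : m%:R != 0 :> R. Proof. by rewrite pnatr_eq0 -lt0n. Qed.

Let fact_neq0 k : k`!%:R != 0 :> R.
Proof. by rewrite pnatr_eq0 -lt0n fact_gt0. Qed.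

Lemma S_term_ge0 n k : 0 <= S_term n k.
Proof. by rewrite divr_ge0 ?exprn_ge0 ?mulr_ge0 ?exprn_ge0. Qed.

Lemma S_term_at0 n : (0 < n)%N -> S_term n 0 = 0.
Proof. by move=> n0; rewrite /S_term muln0 expr0n eqn0Ngt n0 mul0r. Qed.

(** The weights (m^k k!)^-m at k + 1 and k differ by the factor (m (k + 1))^m,
    which is what raising the exponent by m supplies. *)
Lemma S_termD_succ n k :
  S_term (n + m) k.+1 = (m * k.+1)%:R ^+ n * S_term 0 k.
Proof.
have k_neq0 : (m * k.+1)%:R != 0 :> R by rewrite pnatr_eq0 -lt0n muln_gt0 m_gt0.
rewrite /S_term exprD expr0 exprS factS (natrM _ k.+1).
have -> : m%:R * m%:R ^+ k * (k.+1%:R * k`!%:R) =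
          (m * k.+1)%:R * (m%:R ^+ k * k`!%:R) :> R by rewrite natrM; ring.
rewrite [X in _ / X = _]exprMn invfM -!mulrA; congr (_ * _).
by rewrite mulrA divff ?mul1r ?expf_neq0.
Qed.

Lemma S_term_shift n k :
  S_term (n + m) k.+1 =
  \sum_(j < n.+1) ('C(n, j) * m ^ (n - j))%:R * S_term j k.
Proof.
rewrite S_termD_succ mulnS natrD exprDn mulr_suml; apply: eq_bigr => j _.
rewrite /S_term expr0 mul1r mulrA (natrM _ 'C(n, j)) natrX -mulr_natl.
congr (_ / _).
by rewrite mulrA.
Qed.

Lemma is_cvg_S_series0 : cvgn (series (S_term 0)).
Proof.
apply: series_le_cvg (is_cvg_series_exp_coeff 1) => k.
- exact: S_term_ge0.
- by rewrite /exp_coeff /= expr1n divr_ge0.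
rewrite /S_term /exp_coeff /= expr0 expr1n ler_pM2l// lef_pV2 ?posrE.
- rewrite -natrX -natrM -natrX ler_nat.
  have le1 : (0 < m ^ k * k`!)%N by rewrite muln_gt0 expn_gt0 m_gt0 fact_gt0.
  apply: (@leq_trans (m ^ k * k`!)).
    by rewrite leq_pmull// expn_gt0 m_gt0.
  by rewrite -[leqLHS]expn1 leq_pexp2l.
- by rewrite exprn_gt0// mulr_gt0 ?exprn_gt0 ?ltr0n ?fact_gt0.
- by rewrite ltr0n fact_gt0.
Qed.

(** Up to the first term, S_m(n) is dominated by S_m(m), hence by S_m(0), when
    n < m; otherwise its shift is a linear combination of the series with
    smaller exponents. *)
Lemma is_cvg_S_series n : cvgn (series (S_term n)).
Proof.
elim/ltn_ind: n => n IH.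
suff /cvg_series_recl : cvgn (series (fun k => S_term n k.+1)) by move/cvgP.
have [nm|mn] := ltnP n m.
  apply: series_le_cvg is_cvg_S_series0 => k; [exact: S_term_ge0..|].
  rewrite -[leRHS]mul1r -(expr0 (m * k.+1)%:R) -S_termD_succ add0n.
  rewrite ler_wpM2r ?invr_ge0 ?exprn_ge0 ?mulr_ge0 ?exprn_ge0//.
  by rewrite ler_weXn2l ?(ltnW nm)// ler1n muln_gt0 m_gt0.
rewrite -(subnK mn); under eq_fun do rewrite S_term_shift.
apply/cvgP/cvg_series_lincomb => j; apply: IH.
by rewrite (leq_trans (ltn_ord j))// -[leqRHS](subnK mn) -addn1 leq_add2l.
Qed.

Lemma cvg_S_series n : series (S_term n) @ \oo --> (S_series m n : R).
Proof. exact: is_cvg_S_series. Qed.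

Lemma cvg_S_series_shift n : (0 < n)%N ->
  series (fun k => S_term n k.+1) @ \oo --> (S_series m n : R).
Proof.
move=> n0.
have -> : series (fun k => S_term n k.+1) = [sequence series (S_term n) k.+1]_k.
  apply/funext => N.
  by rewrite /series /= big_nat_recl// S_term_at0// add0r.
by rewrite cvg_shiftS; exact: cvg_S_series.
Qed.

Lemma S_series_rec n :
  S_series m (n + m) =
  \sum_(j < n.+1) ('C(n, j) * m ^ (n - j))%:R * S_series m j :> R.
Proof.
have nm0 : (0 < n + m)%N by rewrite addn_gt0 m_gt0 orbT.
rewrite -(cvg_lim _ (cvg_S_series_shift nm0))//; apply: cvg_lim => //.
under eq_fun do rewrite S_term_shift.
by apply: cvg_series_lincomb => j; exact: cvg_S_series.
Qed.

(** S_m and the combination of the mbell m r satisfy the same recurrence of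
    order m and agree for n < m, where mbell m r n is 1 if r = n and else 0. *)
Lemma S_series_mbell n :
  S_series m n = \sum_(r < m) (mbell m r n)%:R * S_series m r :> R.
Proof.
elim/ltn_ind: n => n IH; have [nm|mn] := ltnP n m.
  rewrite (bigD1 (Ordinal nm))//= (proj1 (mbellP _ m_gt0))// eqxx mul1r.
  rewrite big1 ?addr0// => r rn.
  rewrite -val_eqE eq_sym /= in rn.
  by rewrite (proj1 (mbellP _ m_gt0))// (negPf rn) mul0r.
rewrite -(subnK mn) S_series_rec.
under [RHS]eq_bigr do rewrite (proj2 (mbellP _ m_gt0)) natr_sum mulr_suml.
rewrite exchange_big /=; apply: eq_bigr => j _.
rewrite IH; last first.
  by rewrite (leq_trans (ltn_ord j))// -[leqRHS](subnK mn) -addn1 leq_add2l.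
by rewrite mulr_sumr; apply: eq_bigr => r _; rewrite mulrA -natrM.
Qed.

(** For 0 < r, the k-th term of the carrier is the (k+1)-th term of S_m(r):
    (k+1)^r cancels against the factors of ((k+1)!)^m = ((k+1)!)^r
    ((k+1)!)^(m-r), turning ((k+1)!)^r into (k!)^r. *)
Lemma hyper_besselE r : (r < m)%N -> hyper_bessel m r 1 = S_series m r :> R.
Proof.
move=> rm; rewrite /hyper_bessel; case: posnP => [->|r0].
  congr (limn (series _)); apply/funext => k.
  by rewrite expr0 !div1r exprVn [X in _ = X^-1]exprMn -exprM mulnC invfM.
rewrite -(cvg_lim _ (cvg_S_series_shift r0))//.
congr (limn (series _)); apply/funext => k.
have k_neq0 : k.+1%:R != 0 :> R by rewrite pnatr_eq0.
have powm : (m%:R ^+ k.+1) ^+ m = m%:R ^+ r * m%:R ^+ (m * k + m - r) :> R.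
  by rewrite -exprM -exprD subnKC ?(leq_trans (ltnW rm) (leq_addl _ _))//
             mulnC mulnS addnC.
have powf : k.+1`!%:R ^+ m = k.+1`!%:R ^+ r * k.+1`!%:R ^+ (m - r) :> R.
  by rewrite -exprD subnKC// ltnW.
rewrite /S_term div1r exprVn natrM !exprMn powm powf factS natrM !exprMn.
field.
by rewrite !expf_neq0.
Qed.

Lemma S_series0_gt0 : 0 < S_series m 0 :> R.
Proof.
(* The term k = 0 alone contributes 1. *)
have ndS : nondecreasing_seq (series (S_term 0)).
  by apply: nondecreasing_series => k _ _; exact: S_term_ge0.
have := nondecreasing_cvgn_le ndS (@is_cvg_S_series 0) 1%N.
rewrite /series /= big_nat1 /S_term expr0 fact0 mulr1 expr1n divr1.
exact: lt_le_trans.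
Qed.

Lemma hyper_bessel0_neq0 : hyper_bessel m 0 1 != 0 :> R.
Proof. by rewrite hyper_besselE// gt_eqF// S_series0_gt0. Qed.

End S_series_theory.

(** * The distributions *)

Section cmp_distribution.
Variable R : realType.

(** The unnormalised mass of CMP(m^-m, m) at k is S_term 0 k, so that the
    normalising constant is S_m(0). *)
Lemma cmp_pmf_S_term (m n k : nat) : (0 < m)%N ->
  k%:R ^+ n * cmp_pmf (m%:R ^- m) m%:R k =
  (m%:R ^+ n * S_series m 0)^-1 * S_term R m n k :> R.
Proof.
move=> m0.
have m_neq0 : m%:R != 0 :> R by rewrite pnatr_eq0 -lt0n.
have weightE j : (m%:R ^- m) ^+ j / (j`!%:R `^ m%:R) = S_term R m 0 j.
  rewrite powR_mulrn// /S_term expr0 div1r [X in _ = X^-1]exprMn invfM.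
  by rewrite exprVn -!exprM mulnC.
have -> : cmp_pmf (m%:R ^- m) m%:R k = S_term R m 0 k / S_series m 0.
  rewrite /cmp_pmf invfM mulrA weightE; congr (_ / _).
  by congr (limn (series _)); apply/funext => j; exact: weightE.
rewrite /S_term expr0 mul1r natrM (exprMn n) invfM.
move: (S_series m 0)^-1 (_ ^- m) => z w; field.
by rewrite expf_neq0.
Qed.

Lemma cmp_poissonE : cmp_pmf 1 1 = poisson_pmf 1 :> (nat -> R).
Proof.
have Z1 : cmp_Z 1 1 = expR 1 :> R.
  by congr (limn (series _)); apply/funext => j; rewrite powRr1.
apply/funext => k; rewrite /cmp_pmf /poisson_pmf ltr01 Z1 powRr1//.
by rewrite invfM expRN mulrA.
Qed.

Lemma besselI0E : besselI 0 1 = hyper_bessel 2 0 1 :> R.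
Proof.
by congr (limn (series _)); apply/funext => k; rewrite !addn0 expr2.
Qed.

Lemma besselI1E : besselI 1 1 = hyper_bessel 2 1 1 :> R.
Proof.
congr (limn (series _)); apply/funext => k.
by rewrite addn1 expr1 addn2 subn1 /= expr1 addn1.
Qed.

Context d (T : measurableType d) (P : probability T R) (X : {RV P >-> nat}).

Lemma moment_cmp (m n : nat) : (0 < m)%N ->
  has_pmf X (cmp_pmf (m%:R ^- m) m%:R) ->
  ((m%:R ^+ n)%R%:E * moment X n =
     (S_series m n / hyper_bessel m 0 1)%R%:E)%E.
Proof.
move=> m0 Xm.
pose c : R := (m%:R ^+ n * S_series m 0)^-1.
rewrite (moment_series (l := c * S_series m n) Xm).
  rewrite -EFinM hyper_besselE// /c invfM !mulrA divff ?mul1r; last first.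
    by rewrite expf_neq0// pnatr_eq0 -lt0n.
  by rewrite mulrC.
under eq_fun do rewrite cmp_pmf_S_term//.
rewrite [series _](_ : _ = fun N => c * series (S_term R m n) N).
  by apply: cvgMl_tmp; exact: cvg_S_series.
by apply/funext => N; rewrite /series /= mulr_sumr.
Qed.

End cmp_distribution.

Theorem corollary8p4 (d : measure_display) (T : measurableType d)
    (R : realType) (P : probability T R) (X : {RV P >-> nat}) :
  (forall m : nat, (1 <= m)%N ->
     has_pmf X (cmp_pmf (m%:R ^- m) m%:R) ->
     forall n : nat,
       ((m%:R ^+ n)%R%:E * moment X n =
          (\sum_(r < m) (mbell m r n)%:R *
             (hyper_bessel m r 1 / hyper_bessel m 0 1))%R%:E)%E /\
       \sum_(r < m) (mbell m r n)%:R *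
          (hyper_bessel m r 1 / hyper_bessel m 0 1) =
         S_series m n / hyper_bessel m 0 1 :> R) /\
  ((has_pmf X (cmp_pmf 1 1) <-> has_pmf X (poisson_pmf 1)) /\
   (has_pmf X (poisson_pmf 1) ->
      forall n : nat, moment X n = (bell n)%:R%:E)) /\
  (has_pmf X (cmp_pmf (1 / 4) 2) ->
     forall n : nat,
       ((2 ^+ n)%R%:E * moment X n =
          ((mbell 2 0 n)%:R +
             (mbell 2 1 n)%:R * (besselI 1 1 / besselI 0 1))%R%:E)%E).
Proof.
have sumE (m n : nat) : (1 <= m)%N ->
    \sum_(r < m) (mbell m r n)%:R *
      (hyper_bessel m r 1 / hyper_bessel m 0 1) =
    S_series m n / hyper_bessel m 0 1 :> R.
  move=> m0; rewrite S_series_mbell// mulr_suml; apply: eq_bigr => r _.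
  by rewrite mulrA hyper_besselE.
have momE (m : nat) : (1 <= m)%N ->
    has_pmf X (cmp_pmf (m%:R ^- m) m%:R) -> forall n : nat,
    ((m%:R ^+ n)%R%:E * moment X n =
       (\sum_(r < m) (mbell m r n)%:R *
          (hyper_bessel m r 1 / hyper_bessel m 0 1))%R%:E)%E.
  by move=> m0 Xm n; rewrite sumE//; exact: moment_cmp.
split; first by move=> m m0 Xm n; split; [exact: momE|exact: sumE].
split; [split; first by rewrite cmp_poissonE|].
  rewrite -cmp_poissonE => X1 n.
  have := momE 1%N isT; rewrite expr1 invr1 => /(_ X1 n).
  rewrite big_ord1 expr1n mul1e divff ?hyper_bessel0_neq0// mulr1 => ->.
  by rewrite bell_mbell.
move=> X2 n.
have := momE 2%N isT; rewrite (_ : 2%:R ^- 2 = 1 / 4); last by field.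
move=> /(_ X2 n) ->; rewrite big_ord_recl big_ord1 besselI0E besselI1E.
by rewrite divff ?hyper_bessel0_neq0// mulr1.
Qed.
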